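(* Let $H$ be a graph of diameter at least $\ell\geq 2$ and let $n\geq 1$. If the Cartesian product $K_n\,\square\,H$ is $\ell$-distance-balanced, then $H$ is $\ell$-distance-balanced.
   Context: All graphs are finite, simple, undirected and connected. $d_G$ denotes the geodesic distance in $G$ and $\mathrm{diam}(G)$ the maximum distance between pairs of vertices of $G$. For vertices $u,v$ of $G$, $W_{uv}=\{w\in V(G): d_G(w,u)<d_G(w,v)\}$. For a positive integer $\ell$, a graph $G$ with $\mathrm{diam}(G)\geq\ell$ is $\ell$-distance-balanced if $|W_{uv}|=|W_{vu}|$ for all $u,v\in V(G)$ with $d_G(u,v)=\ell$. $K_n$ is the complete graph on $n$ vertices. The Cartesian product $G\,\square\,H$ has vertex set $V(G)\times V(H)$, and $(g_1,h_1)$ and $(g_2,h_2)$ are adjacent if either $g_1=g_2$ and $h_1h_2\in E(H)$, or $h_1=h_2$ and $g_1g_2\in E(G)$. *)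

(* Defs.v *)
From mathcomp Require Import all_boot.

Set Implicit Arguments.
Unset Strict Implicit.
Unset Printing Implicit Defensive.

(* Finite simple undirected connected graphs. The empty graph is not excluded,
   so that K_0 below is well defined. *)
Record graph := Graph {
  vertex :> finType;
  adj : rel vertex;
  adj_sym : symmetric adj;
  adj_irr : irreflexive adj;
  adj_conn : forall u v, connect adj u v
}.

Section Distance.

Variable G : graph.
Implicit Types (u v w : G) (k l : nat).

Definition walk u v k :=
  [exists p : k.-tuple G, path (@adj G) u p && (v == last u p)].

Lemma walk_exists u v : exists k, walk u v k.
Proof.
have /connectP[p pP ->] := adj_conn u v.
exists (size p); apply/existsP; exists (in_tuple p).
by rewrite pP eqxx.
Qed.

Definition dist u v : nat := ex_minn (walk_exists u v).

Definition diam : nat := \max_(u : G) \max_(v : G) dist u v.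

Definition closer u v : {set G} := [set w | dist w u < dist w v].

Definition distance_balanced l : Prop :=
  l <= diam /\ forall u v, dist u v = l -> #|closer u v| = #|closer v u|.

End Distance.

Section Complete.

Variable n : nat.

Definition complete_adj : rel 'I_n := fun i j => i != j.

Lemma complete_adj_sym : symmetric complete_adj.
Proof. by move=> i j; rewrite /complete_adj eq_sym. Qed.

Lemma complete_adj_irr : irreflexive complete_adj.
Proof. by move=> i; rewrite /complete_adj eqxx. Qed.

Lemma complete_adj_conn i j : connect complete_adj i j.
Proof.
by have [->|neq_ij] := eqVneq i j; [exact: connect0 | exact: connect1].
Qed.

Definition complete_graph : graph :=
  Graph complete_adj_sym complete_adj_irr complete_adj_conn.

End Complete.

Section CartesianProduct.

Variables G H : graph.

Definition cart_adj : rel (G * H) := fun x y =>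
  (x.1 == y.1) && adj x.2 y.2 || (x.2 == y.2) && adj x.1 y.1.

Lemma cart_adj_sym : symmetric cart_adj.
Proof.
move=> x y; rewrite /cart_adj (adj_sym x.1) (adj_sym x.2).
by rewrite (eq_sym x.1) (eq_sym x.2).
Qed.

Lemma cart_adj_irr : irreflexive cart_adj.
Proof. by move=> x; rewrite /cart_adj !adj_irr !andbF. Qed.

Lemma cart_adj_conn x y : connect cart_adj x y.
Proof.
case: x y => [g h] [g' h']; apply: (@connect_trans _ _ (g', h)).
  have /connectP[p + ->] := adj_conn g g'.
  elim: p g => [|a p IHp] g /=; first by rewrite connect0.
  case/andP=> ga /IHp; apply: connect_trans; apply: connect1.
  by rewrite /cart_adj /= eqxx ga orbT.
have /connectP[p + ->] := adj_conn h h'.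
elim: p h => [|a p IHp] h /=; first by rewrite connect0.
case/andP=> ha /IHp; apply: connect_trans; apply: connect1.
by rewrite /cart_adj /= eqxx ha.
Qed.

Definition cart_prod : graph := Graph cart_adj_sym cart_adj_irr cart_adj_conn.

End CartesianProduct.

(* Main.v *)
Require Import Defs.
From mathcomp Require Import all_boot.

(** Distances in a Cartesian product add up coordinatewise ([dist_cart_prod]).
    Hence, for a fixed vertex [g] of [G], the copies [(g, u)] and [(g, v)] of
    two vertices of [H] are as far apart as [u] and [v], and a vertex [(j, w)]
    is closer to [(g, u)] than to [(g, v)] exactly when [w] is closer to [u]
    than to [v], because the summand [dist j g] occurs on both sides.  So
    [closer (g, u) (g, v)] is the full preimage of [closer u v] under the
    projection to [H] ([closer_cart_prod]) and has [#|G|] times its size.  For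
    [G] nonempty, the factor [#|G|] cancels from the balance condition of the
    product on such pairs, which leaves that of [H]. *)

Section DistanceByPaths.

Variable G : graph.
Implicit Types (u v w : G) (p : seq G).

Lemma dist_le_size u p : path (@adj G) u p -> dist u (last u p) <= size p.
Proof.
move=> up; rewrite /dist; case: ex_minnP => k _; apply.
by apply/existsP; exists (in_tuple p); rewrite up eqxx.
Qed.

Lemma geodesic_exists u v :
  exists p, [/\ path (@adj G) u p, last u p = v & size p = dist u v].
Proof.
rewrite /dist; case: ex_minnP => k /existsP[p /andP[up /eqP ->]] _.
by exists p; rewrite size_tuple.
Qed.

Lemma dist_refl u : dist u u = 0.
Proof. by apply/eqP; rewrite -leqn0; exact: (@dist_le_size u [::]). Qed.

Lemma dist_adj u a v : adj u a -> dist u v <= (dist a v).+1.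
Proof.
move=> ua; have [p [ap <- <-]] := geodesic_exists a v.
by apply: (@dist_le_size u (a :: p)); rewrite /= ua.
Qed.

End DistanceByPaths.

Section CartesianProductDistance.

Variables G H : graph.
Implicit Types (g : G) (u v h : H) (x y : cart_prod G H).

(** Each edge of the product moves one coordinate along an edge and fixes the
    other, so it lowers the sum of the coordinate distances by at most one. *)
Lemma coord_dist_le_size x (p : seq (cart_prod G H)) :
  path (@adj (cart_prod G H)) x p ->
  dist x.1 (last x p).1 + dist x.2 (last x p).2 <= size p.
Proof.
elim: p x => [|y p IHp] x /=; first by rewrite !dist_refl.
case/andP=> xy /IHp; rewrite -ltnS; apply: leq_trans.
case/orP: xy => /andP[/eqP -> /dist_adj xy].
  by rewrite -addnS leq_add2l.
by rewrite -addSn leq_add2r.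
Qed.

(** For the upper bound, follow a geodesic of [G] inside the layer of [x.2],
    then a geodesic of [H] inside the layer of [y.1]. *)
Lemma dist_cart_prod x y : dist x y = dist x.1 y.1 + dist x.2 y.2.
Proof.
apply/eqP; rewrite eqn_leq; apply/andP; split; last first.
  by have [p [xp <- <-]] := geodesic_exists _ x y; exact: coord_dist_le_size.
case: x y => [g h] [g' h'] /=.
have [p [gp lastp <-]] := geodesic_exists _ g g'.
have [q [hq lastq <-]] := geodesic_exists _ h h'.
pose r : seq (cart_prod G H) := [seq (a, h) | a <- p] ++ [seq (g', b) | b <- q].
have lastr : last (g, h) r = (g', h').
  by rewrite last_cat (last_map (fun a => (a, h))) lastp
             (last_map (pair g')) lastq.
have -> : size p + size q = size r by rewrite size_cat !size_map.
rewrite -lastr; apply: (@dist_le_size (cart_prod G H)).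
rewrite cat_path (last_map (fun a => (a, h))) lastp; apply/andP; split.
  apply: (homo_path (f := fun a => (a, h)) _ gp) => a b ab.
  by rewrite /= /cart_adj /= eqxx ab orbT.
apply: (homo_path (f := pair g') _ hq) => a b ab.
by rewrite /= /cart_adj /= eqxx ab.
Qed.

Lemma closer_cart_prod g u v :
  @closer (cart_prod G H) (g, u) (g, v) = setX [set: G] (closer u v).
Proof.
by apply/setP=> -[j w]; rewrite !inE /= !dist_cart_prod /= ltn_add2l.
Qed.

Lemma distance_balanced_right_factor g l :
  l <= diam H -> distance_balanced (cart_prod G H) l -> distance_balanced H l.
Proof.
move=> diamH [_ balGH]; split=> // u v uvl.
have /balGH : @dist (cart_prod G H) (g, u) (g, v) = l.
  by rewrite dist_cart_prod /= dist_refl.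
rewrite !closer_cart_prod !cardsX cardsT => /eqP.
by rewrite eqn_pmul2l => [/eqP //|]; apply/card_gt0P; exists g.
Qed.

End CartesianProductDistance.

Theorem proposition5p3 (H : graph) (l n : nat) (l_ge2 : 2 <= l)
    (diamH : l <= diam H) (n_gt0 : 1 <= n)
    (balanced_KnH : distance_balanced (cart_prod (complete_graph n) H) l) :
  distance_balanced H l.
Proof.
exact: (@distance_balanced_right_factor (complete_graph n) H (Ordinal n_gt0)).
Qed.
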